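(* Let $\xi^*=\sum_{d=1}^S w_d^*\bar\xi_d$ be an invariant design which is $D$-optimal on $\mathcal{X}^{(S)}$ (i.e. $\mathbf{M}(\xi^* )$ is nonsingular and $\det\mathbf{M}(\xi^* )\ge\det\mathbf{M}(\xi)$ for every approximate design $\xi$ on $\mathcal{X}^{(S)}$). Then the set $\{d: w^*_d>0\}$ of comparison depths used by $\xi^*$ has at most three elements, and it is contained in $\{d^*,d^*+1,S\}$ for some $d^*\in\{1,\dots,S\}$.
   Context: Fix integers $v\ge 2$, $K\ge 3$ and $S$ with $3\le S\le K$. Let $\mathbf{e}_i$ denote the $i$th unit vector of $\mathbb{R}^{v-1}$ and $\mathbf{1}_{v-1}$ the all-ones vector. Define $\mathbf{f}_1:\{0,1,\dots,v\}\to\mathbb{R}^{v-1}$ by $\mathbf{f}_1(i)=\mathbf{e}_i$ for $1\le i\le v-1$, $\mathbf{f}_1(v)=-\mathbf{1}_{v-1}$, $\mathbf{f}_1(0)=\mathbf{0}$. For $\mathbf{i}\in\{0,\dots,v\}^K$ let $\mathbf{f}(\mathbf{i})\in\mathbb{R}^p$ stack $\mathbf{f}_1(i_k)$ ($k=1,\dots,K$), then $\mathbf{f}_1(i_k)\otimes\mathbf{f}_1(i_\ell)$ ($k<\ell$), then $\mathbf{f}_1(i_k)\otimes\mathbf{f}_1(i_\ell)\otimes\mathbf{f}_1(i_m)$ ($k<\ell<m$); $p=K(v-1)+\binom K2(v-1)^2+\binom K3(v-1)^3$. The design region $\mathcal{X}^{(S)}$ is the set of ordered pairs $(\mathbf{i},\mathbf{j})$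 in $\{0,\dots,v\}^K$ for which there is a set $A$ of exactly $S$ attributes with $i_k,j_k\in\{1,\dots,v\}$ for $k\in A$ and $i_k=j_k=0$ for $k\notin A$; $\mathcal{X}^{(S)}_d$ (comparison depth $d$) is the subset with $i_k\ne j_k$ for exactly $d$ indices $k$. An approximate design is a finitely supported probability measure $\xi$ on $\mathcal{X}^{(S)}$ with information matrix $\mathbf{M}(\xi)=\sum\xi(\mathbf{i},\mathbf{j})(\mathbf{f}(\mathbf{i})-\mathbf{f}(\mathbf{j}))(\mathbf{f}(\mathbf{i})-\mathbf{f}(\mathbf{j}))^\top$; $\bar\xi_d$ is the uniform design on $\mathcal{X}^{(S)}_d$, and designs $\sum_{d=1}^S w_d\bar\xi_d$ ($w_d\ge0$, $\sum w_d=1$) are called invariant. *)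

(* Defs.v *)
From HB Require Import structures.
From mathcomp Require Import all_boot all_order all_algebra.
Set Implicit Arguments. Unset Strict Implicit. Unset Printing Implicit Defensive.
Import Order.TTheory GRing.Theory Num.Theory.
Local Open Scope ring_scope.

Section Design.
Variable R : rcfType.
Variables (K v : nat).

(* attribute levels {0,...,v}; 0 = attribute absent *)
Definition level := 'I_v.+1.
Definition profile := {ffun 'I_K -> 'I_v.+1}.
Definition pairT := (profile * profile)%type.

(* f_1 : {0,..,v} -> R^(v-1); coordinate a : 'I_(v-1) (0-based).
   f_1(i) = e_i for 1<=i<=v-1, f_1(v) = -1, f_1(0) = 0. *)
Definition f1 (i : 'I_v.+1) (a : 'I_v.-1) : R :=
  if (i == 0 :> nat) then 0
  else if (i == v :> nat) then -1
  else ((i.-1 == a :> nat)%N)%:R.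

(* Coordinates of the regression vector f : one coordinate for each choice of a
   set of 1, 2 or 3 attributes k1<..<km and, for each chosen attribute, a
   coordinate a in {1..v-1}; the value is the product of the corresponding
   coordinates of f_1(i_k), i.e. the entry of f_1(i_k1) (x) ... (x) f_1(i_km).
   Encoded as partial maps 'I_K -> option 'I_(v-1) with 1..3 defined entries. *)
Definition fidx_pred (j : {ffun 'I_K -> option 'I_v.-1}) : bool :=
  (0 < #|[pred k | j k != None]|)%N && (#|[pred k | j k != None]| <= 3)%N.
Definition fidx := {j : {ffun 'I_K -> option 'I_v.-1} | fidx_pred j}.

(* p = K(v-1) + C(K,2)(v-1)^2 + C(K,3)(v-1)^3 *)
Definition p := #|{: fidx}|.

Definition fval (i : profile) (j : fidx) : R :=
  \prod_(k : 'I_K) (match val j k with None => 1 | Some a => f1 (i k) a end).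

Definition fdiff (x : pairT) (r : 'I_p) : R :=
  fval x.1 (enum_val r) - fval x.2 (enum_val r).

Definition inX (S : nat) (x : pairT) : bool :=
  [exists A : {set 'I_K}, (#|A| == S) &&
     [forall k, if k \in A then (x.1 k != 0 :> nat) && (x.2 k != 0 :> nat)
                else (x.1 k == 0 :> nat) && (x.2 k == 0 :> nat)]].

Definition depth (x : pairT) : nat := #|[pred k | x.1 k != x.2 k]|.

Definition inXd (S d : nat) (x : pairT) : bool := inX S x && (depth x == d).

Definition is_design (S : nat) (xi : {ffun pairT -> R}) : Prop :=
  (forall x, 0 <= xi x) /\ (\sum_x xi x = 1) /\ (forall x, xi x != 0 -> inX S x).

Definition infoM (xi : {ffun pairT -> R}) : 'M[R]_p :=
  \matrix_(r, c) \sum_x xi x * fdiff x r * fdiff x c.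

Definition unif (S d : nat) : {ffun pairT -> R} :=
  [ffun x => if inXd S d x then (#|[pred y | inXd S d y]|%:R)^-1 else 0].

Definition invdesign (S : nat) (w : nat -> R) : {ffun pairT -> R} :=
  [ffun x => \sum_(1 <= d < S.+1) w d * unif S d x].

Definition D_optimal (S : nat) (xi : {ffun pairT -> R}) : Prop :=
  is_design S xi /\ \det (infoM xi) != 0 /\
  forall eta, is_design S eta -> \det (infoM eta) <= \det (infoM xi).

End Design.

(* Main.v *)
Require Import Defs.
From HB Require Import structures.
From mathcomp Require Import all_boot all_order all_algebra.
From mathcomp Require Import polyrcf ring lra zify.
Import Order.TTheory GRing.Theory Num.Theory.
Local Open Scope ring_scope.

(* The sum of prod_k u_k(i_k, j_k) over the pairs with S active attributes and
   depth d is the coefficient of Y^S X^d in prod_k (z_k + Y (e_k + s_k X)), where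
   z_k, e_k, s_k are the sums of u_k over {(0,0)}, over the equal nonzero levels
   and over the distinct nonzero levels.  An entry of M(xi_d) involves the sets B
   and C of at most three attributes.  If B <> C, then z_k = e_k = s_k = 0 for some
   k, because f_1 sums to zero; if B = C, all factors outside B are
   1 + v Y (1 + (v-1) X), and dividing by the number of pairs leaves a polynomial
   in d of degree at most 3.  Hence V(d) = tr(M^-1 M(xi_d)), where M = M(xi^* ), is a
   cubic in d, and V(0) = 0.  D-optimality gives V(d) <= p on 1..S, with equality
   where w_d > 0.  A cubic that is negative at 0, nonpositive at 1..S and vanishes
   at integers a < b <= S has b = a+1 or b = S: otherwise, in its factorization
   (x-a)(x-b)l(x), the linear l is negative at 0 and nonnegative at a+1, so the
   cubic is positive at b+1 <= S. *)

(** * Integer roots of a cubic and the shape of the support *)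

Lemma root_gap_le1 (R : rcfType) (q : {poly R}) (S a b : nat) :
    (size q <= 4)%N -> q.[0] < 0 ->
    (forall d, (1 <= d <= S)%N -> q.[d%:R] <= 0) ->
    (1 <= a)%N -> (a < b)%N -> (b <= S)%N -> root q a%:R -> root q b%:R ->
  b = a.+1 \/ b = S.
Proof.
move=> szq q0 qle a1 ab bS ra rb.
have [q1 q1E] := factor_theorem _ _ ra.
have rb1 : root q1 b%:R.
  move: rb; rewrite q1E rootM root_XsubC eqr_nat => /orP[//|/eqP ba].
  by rewrite ba ltnn in ab.
have [l lE] := factor_theorem _ _ rb1.
have qn0 : q != 0 by apply: contraTneq q0 => ->; rewrite horner0 ltxx.
have szl : (size l <= 2)%N.
  have q1n0 : q1 != 0 by apply: contraNneq qn0 => q10; rewrite q1E q10 mul0r.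
  have ln0 : l != 0 by apply: contraNneq q1n0 => l0; rewrite lE l0 mul0r.
  by move: szq; rewrite q1E lE !size_Mmonic ?monicXsubC -?lE // !size_XsubC !addn2.
have lx x : l.[x] = l`_0 + l`_1 * x.
  rewrite (horner_coef_wide x szl) big_ord_recr big_ord1 /= expr0 expr1.
  by rewrite mulr1.
have qx x : q.[x] = (l`_0 + l`_1 * x) * (x - b%:R) * (x - a%:R).
  by rewrite q1E lE !hornerE -lx.
have [->|bne] := eqVneq b a.+1; first by left.
right; apply/eqP; rewrite eqn_leq bS /=; apply/negPn/negP => nSb.
have a0 : 0 < a%:R :> R by rewrite ltr0n.
have b2a : a%:R + 2 <= b%:R :> R.
  by rewrite -natrD ler_nat addn2 ltn_neqAle eq_sym bne.
have qa : q.[a.+1%:R] <= 0 by apply: qle; lia.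
have qb : q.[b.+1%:R] <= 0 by apply: qle; lia.
move: q0 qa qb; rewrite !qx -!natr1.
move: (l`_0) (l`_1) (a%:R : R) (b%:R : R) a0 b2a => c m x y x0 yx.
have -> : (c + m * 0) * (0 - y) * (0 - x) = c * (x * y) by ring.
have xy0 : 0 < x * y by apply: mulr_gt0; lra.
rewrite pmulr_llt0 // => c0.
rewrite [x + 1 - x]addrAC subrr add0r mulr1 nmulr_lle0; last by lra.
move=> h1.
have m0 : 0 < m.
  have : 0 < m * (x + 1) by lra.
  by rewrite pmulr_lgt0 //; lra.
have h2 : 0 < c + m * (y + 1).
  have : 0 < m * (y - x) by apply: mulr_gt0; lra.
  lra.
rewrite [y + 1 - y]addrAC subrr add0r mulr1 pmulr_lle0; first by lra.
lra.
Qed.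

(** The least element of [P] serves as [ds]: the gap condition compares every larger element with
    it. If [P] is empty, any value in the range will do. *)
Lemma support_shape (P : pred nat) (S : nat) :
    (1 <= S)%N -> (forall d, P d -> (1 <= d <= S)%N) ->
    (forall a b, P a -> P b -> (a < b)%N -> b = a.+1 \/ b = S) ->
  exists2 ds : nat, (1 <= ds <= S)%N &
    forall d, P d -> d = ds \/ d = ds.+1 \/ d = S.
Proof.
move=> S1 PS gap.
have [/hasP[d0 _ Pd0]|/hasPn noP] := boolP (has P (iota 1 S)).
  have exP : exists d, P d by exists d0.
  case: (ex_minnP exP) => m Pm mmin.
  exists m => [|d Pd]; first exact: PS.
  have := mmin _ Pd; rewrite leq_eqVlt => /orP[/eqP->|md]; first by left.
  by right; apply: gap.
exists 1%N => [//|d Pd]; have := noP d; rewrite mem_iota add1n ltnS (PS _ Pd) Pd.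
by move=> /(_ isT).
Qed.

(** * Determinants, traces and positivity *)

Lemma horner_char_poly (R : comNzRingType) (n : nat) (A : 'M[R]_n) (s : R) :
  (char_poly A).[s] = \det (s%:M - A).
Proof.
rewrite -horner_evalE -det_map_mx /=; congr (\det _).
by apply/matrixP => i j; rewrite !mxE horner_evalE !(hornerE, hornerMn).
Qed.

(* char_poly (- M) is monic without roots in [0, +oo[, hence positive at 0. *)
Lemma det_gt0_posdef (R : rcfType) (n : nat) (M : 'M[R]_n) :
    (forall x : 'rV_n, 0 <= (x *m M *m x^T) 0 0) -> \det M != 0 ->
  0 < \det M.
Proof.
move=> Mpsd detM; set P := char_poly (- M).
have PE s : P.[s] = \det (s%:M + M) by rewrite horner_char_poly opprK.
have Pn0 s : 0 <= s -> ~~ root P s.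
  rewrite le_eqVlt => /orP[/eqP <-|s0].
    by rewrite rootE PE (_ : 0%:M = 0) ?add0r // raddf0.
  rewrite rootE PE -unitfE; change (s%:M + M \in unitmx); rewrite -row_free_unit.
  (* If x (s + M) = 0, then s |x|^2 = - x M x^T <= 0, so x = 0 because s > 0. *)
  apply: inj_row_free => x xM0.
  have /(congr1 (fun A : 'M[R]_1 => A 0 0)) : x *m (s%:M + M) *m x^T = 0.
    by rewrite xM0 mul0mx.
  rewrite mulmxDr mulmxDl mul_mx_scalar -scalemxAl !mxE => h.
  have xx : \sum_j x 0 j ^+ 2 = 0.
    have sq0 : 0 <= \sum_j x 0 j ^+ 2 by apply: sumr_ge0 => j _; exact: sqr_ge0.
    have := Mpsd x; rewrite !mxE => M0.
    have e : \sum_j x 0 j * x^T j 0 = \sum_j x 0 j ^+ 2.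
      by apply: eq_bigr => j _; rewrite mxE -expr2.
    move: h; rewrite e => h.
    apply/eqP; rewrite eq_le sq0 andbT -(pmulr_rle0 _ s0).
    by rewrite -[_ * _](addrK (\sum_j (x *m M) 0 j * x^T j 0)) h sub0r oppr_le0.
  apply/rowP => j; rewrite mxE; apply/eqP; rewrite -sqrf_eq0.
  by move: xx => /psumr_eq0P -> // i _; exact: sqr_ge0.
have [m Pm] : exists m, forall x, m <= x -> lead_coef P <= P.[x].
  by apply: poly_pinfty_gt_lc; rewrite (monicP (char_poly_monic _)).
rewrite (monicP (char_poly_monic _)) in Pm.
have -> : \det M = P.[0] by rewrite PE (_ : 0%:M = 0) ?add0r // raddf0.
rewrite ltNge; apply/negP => P0.
have [||x /andP[x0 _] rx] := @poly_ivt _ P 0 (Num.max 0 m).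
- by rewrite le_max lexx.
- by rewrite P0 (le_trans ler01) // Pm // le_max lexx orbT.
by rewrite (negPf (Pn0 _ x0)) in rx.
Qed.

(* tr B is the coefficient of s^(n-1) in det (s + B) = s^n det (1 + s^-1 B). *)
Lemma trace_le0_det (R : rcfType) (n : nat) (B : 'M[R]_n) :
    (forall t, 0 <= t <= 1 -> \det (1%:M + t *: B) <= 1) ->
  \tr B <= 0.
Proof.
move=> Hdet; rewrite leNgt; apply/negP => trB.
have n0 : (0 < n)%N.
  by case: n B trB {Hdet} => // B; rewrite /mxtrace big_ord0 ltxx.
pose Q := char_poly (- B) - 'X^n.
have szQ : (size Q <= n)%N.
  apply/leq_sizeP => j nj; rewrite coefB coefXn.
  have := monicP (char_poly_monic (- B)).
  rewrite lead_coefE size_char_poly /= => lc.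
  move: nj; rewrite leq_eqVlt => /orP[/eqP <-|nj]; first by rewrite lc eqxx subrr.
  by rewrite nth_default ?size_char_poly // eq_sym ltn_eqF // subr0.
have Qn : Q`_n.-1 = \tr B.
  rewrite coefB coefXn char_poly_trace // raddfN opprK.
  by rewrite ltn_eqF ?subr0 // prednK.
have szQE : size Q = n.
  apply/eqP; rewrite eqn_leq szQ /= -(prednK n0) ltnNge; apply/negP => h.
  by move: trB; rewrite -Qn nth_default ?ltxx.
have [|m Qm] := @poly_pinfty_gt_lc _ Q.
  by rewrite lead_coefE szQE Qn.
(* The bound s >= 1 puts t = s^-1 in [0, 1], so [Hdet] gives Q(s) <= 0; the bound s >= m gives Q(s)
   >= tr B > 0. *)
pose s := Num.max 1 m.
have s1 : 1 <= s by rewrite le_max lexx.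
have s0 : 0 < s by apply: lt_le_trans s1.
have := Qm s; rewrite le_max lexx orbT => /(_ isT).
rewrite lead_coefE szQE Qn leNgt => /negP; apply; apply: le_lt_trans trB.
rewrite !hornerE horner_char_poly opprK subr_le0.
have -> : s%:M + B = s *: (1%:M + s^-1 *: B).
  by rewrite scalerDr scalerA divff ?gt_eqF // scale1r scalemx1.
rewrite detZ ger_pMr ?exprn_gt0 //; apply: Hdet.
by rewrite invr_ge0 ltW //= invf_le1.
Qed.

(** * Generating function by number of active attributes and depth *)

Section GeneratingFunction.
Variables (R : rcfType) (K v : nat).
Implicit Types (x : pairT K v) (u : 'I_K -> level v * level v -> R).

Lemma inXE S x : inX S x =
  [forall k, (x.1 k == ord0) == (x.2 k == ord0)] &&
  (#|[pred k | x.1 k != ord0]| == S).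
Proof.
apply/existsP/andP => [[A /andP[/eqP AS /forallP hA]]|[/forallP h0 /eqP hS]].
  have eA k : (k \in A) = (x.1 k != ord0).
    have := hA k; rewrite !(inj_eq val_inj _ ord0).
    by case: (k \in A) => /andP[]; case: eqP.
  split.
    apply/forallP => k; have := hA k; rewrite eA !(inj_eq val_inj _ ord0).
    by case: eqP => _ /= => [->|/negPf ->].
  by rewrite -AS; apply/eqP/eq_card => k; rewrite inE eA.
exists [set k | x.1 k != ord0]; rewrite cardsE hS eqxx /=.
apply/forallP => k; have /eqP := h0 k.
by rewrite inE !(inj_eq val_inj _ ord0) => <-; case: eqP.
Qed.

(* The outer variable marks the active attributes, the inner one those on
   which the two profiles differ. *)
Definition marker (ab : level v * level v) : {poly {poly R}} :=
  if (ab.1 == ord0) != (ab.2 == ord0) then 0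
  else 'X^(ab.1 != ord0) * ('X^(ab.1 != ab.2))%:P.

(** The product is a single monomial recording the number of active attributes and the depth, or 0
    as soon as some attribute is active in only one profile. *)
Lemma coef_prod_marker S d x :
  (\prod_k marker (x.1 k, x.2 k))`_S`_d = (inXd S d x)%:R.
Proof.
rewrite /inXd inXE; case: forallP => [h0|] /=.
  have -> : \prod_k marker (x.1 k, x.2 k) =
    'X^(#|[pred k | x.1 k != ord0]|) * ('X^(depth x))%:P.
    rewrite /depth -!sum1_card -!prodrXr rmorph_prod /=.
    rewrite [X in X * _]big_mkcond [X in _ * X]big_mkcond -big_split /=.
    by apply: eq_bigr => k _; rewrite /marker /= !inE -(eqP (h0 k)) eqxx /=; do 2!case: eqP.
  rewrite mulrC coefCM coefXn eq_sym; case: eqP => _ /=.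
    by rewrite mulr1 coefXn eq_sym.
  by rewrite mulr0 coef0.
move=> /forallP; rewrite negb_forall => /existsP[k hk].
by rewrite (bigD1 k) //= /marker /= hk mul0r !coef0.
Qed.

(** Expanding the product of sums chooses a pair of levels for each attribute, that is, a pair of
    profiles; the coefficient keeps those of the right size and depth. *)
Lemma sum_prod_inXd u S d :
  \sum_(x | inXd S d x) \prod_k u k (x.1 k, x.2 k) =
  (\prod_k \sum_ab marker ab * (u k ab)%:P%:P)`_S`_d.
Proof.
rewrite bigA_distr_bigA /= !coef_sum big_mkcond /=.
rewrite (reindex (fun f : {ffun 'I_K -> level v * level v} =>
   ([ffun k => (f k).1], [ffun k => (f k).2]) : pairT K v)) /=; last first.
  exists (fun x => [ffun k => (x.1 k, x.2 k)]) => [f|[x y]] _ /=.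
    by apply/ffunP => k; rewrite !ffunE; case: (f k).
  by congr (_, _); apply/ffunP => k; rewrite !ffunE.
apply: eq_bigr => f _; set x := (X in inXd _ _ X).
have -> : \prod_k (marker (f k) * (u k (f k))%:P%:P) =
   (\prod_k marker (x.1 k, x.2 k)) * (\prod_k u k (x.1 k, x.2 k))%:P%:P.
  rewrite !rmorph_prod -big_split /=; apply: eq_bigr => k _.
  by rewrite !ffunE; case: (f k).
rewrite !coefMC coef_prod_marker; case: inXd; last by rewrite mul0r.
by rewrite mul1r; apply: eq_bigr => k _; rewrite !ffunE.
Qed.

(** The weights are z_k, e_k and s_k: a pair with exactly one zero level has marker 0, the others
    have marker 1, Y or Y X. *)
Lemma sum_marker (w : level v * level v -> R) :
  \sum_ab marker ab * (w ab)%:P%:P =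
  (w (ord0, ord0))%:P%:P +
  'X * ((\sum_(a | a != ord0) w (a, a))%:P +
        (\sum_(a | a != ord0) \sum_(b | (b != ord0) && (b != a)) w (a, b))%:P * 'X)%:P.
Proof.
rewrite (eq_bigr (fun ab => marker (ab.1, ab.2) * (w (ab.1, ab.2))%:P%:P)); last first.
  by case.
rewrite -(pair_bigA _ (fun a b => marker (a, b) * (w (a, b))%:P%:P)) /=.
rewrite (bigD1 ord0) //=; congr (_ + _).
  rewrite (bigD1 ord0) //= big1 ?addr0; first by rewrite /marker /= mul1r mul1r.
  by move=> b b0; rewrite /marker /= (negPf b0) mul0r.
rewrite polyCD mulrDr polyCM !rmorph_sum /= !mulr_suml !mulr_sumr -big_split /=.
apply: eq_bigr => a a0; rewrite (bigD1 a) //=; congr (_ + _).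
  by rewrite /marker /= (negPf a0) !eqxx /= expr1 mulr1.
rewrite !rmorph_sum /= mulr_suml mulr_sumr (bigID (fun b => b == ord0)) /= big1 ?add0r.
  apply: eq_big => [b|b /andP[ba b0]]; first by rewrite andbC.
  rewrite /marker /= (negPf a0) (negPf b0) eq_sym ba /= !expr1.
  by rewrite -mulrA [_%:P%:P * _]mulrC.
move=> b /andP[_ /eqP ->]; rewrite /marker /= (negPf a0) eqxx mul0r //.
Qed.

End GeneratingFunction.

(** * Falling factorials and polynomial functions of the depth *)

(** This makes C(S-b, d-t) / C(S, d) visibly polynomial in d. Multiplied by (d-t)! (S-d-(b-t))!,
    both sides become S!; if S-d < b-t, both are 0. *)
Lemma bin_ffact_ratio S b d t : (t <= b)%N -> (b <= S)%N -> (t <= d)%N -> (d <= S)%N ->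
  ('C(S - b, d - t) * S ^_ b = 'C(S, d) * (d ^_ t * (S - d) ^_ (b - t)))%N.
Proof.
move=> tb bS td dS.
have [lt|le] := ltnP (S - d) (b - t).
  by rewrite [(S - d) ^_ _]ffact_small // bin_small ?muln0 //; lia.
have r0 : (0 < (d - t)`! * (S - d - (b - t))`!)%N by rewrite muln_gt0 !fact_gt0.
apply/eqP; rewrite -(eqn_pmul2r r0); apply/eqP.
have e : ((S - b) - (d - t) = S - d - (b - t))%N by lia.
have h1 : ('C(S - b, d - t) * ((d - t)`! * (S - d - (b - t))`!) = (S - b)`!)%N.
  by rewrite -e bin_fact //; lia.
transitivity (S`!).
  by rewrite mulnAC h1 mulnC ffact_fact.
rewrite -(bin_fact dS) -(ffact_fact td) -(ffact_fact le); ring.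
Qed.

Section PolyFun.
Variables (R : idomainType) (S : nat).

(** Agreement is required only for [d <= S], where the truncated subtraction [S - d] is exact; the
    value at 0 is included. *)
Definition polyfun (n : nat) (f : nat -> R) :=
  exists2 q : {poly R}, (size q <= n.+1)%N & forall d, (d <= S)%N -> f d = q.[d%:R].

Lemma eq_polyfun n f g : (forall d, (d <= S)%N -> f d = g d) -> polyfun n f -> polyfun n g.
Proof. by move=> fg [q sq qE]; exists q => // d dS; rewrite -fg ?qE. Qed.

Lemma polyfunW m n f : (m <= n)%N -> polyfun m f -> polyfun n f.
Proof. by move=> mn [q sq qE]; exists q => //; apply: leq_trans sq _. Qed.

Lemma polyfun_const n c : polyfun n (fun=> c).
Proof.
exists c%:P => [|d _]; last by rewrite hornerC.
exact: leq_trans (size_polyC_leq1 _) _.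
Qed.

Lemma polyfunZ n c f : polyfun n f -> polyfun n (fun d => c * f d).
Proof.
case=> q sq qE; exists (c *: q) => [|d dS]; last by rewrite hornerZ qE.
exact: leq_trans (size_scale_leq _ _) sq.
Qed.


Lemma polyfunD n f g : polyfun n f -> polyfun n g -> polyfun n (fun d => f d + g d).
Proof.
move=> [q sq qE] [r sr rE]; exists (q + r) => [|d dS]; last by rewrite hornerD qE ?rE.
by rewrite (leq_trans (size_polyD _ _)) // geq_max sq sr.
Qed.

Lemma polyfun_sum n (I : Type) (r : seq I) (f : I -> nat -> R) :
  (forall i, polyfun n (f i)) -> polyfun n (fun d => \sum_(i <- r) f i d).
Proof.
move=> Hf; elim: r => [|i r IH].
  by apply: eq_polyfun (polyfun_const n 0) => d _; rewrite big_nil.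
by apply: eq_polyfun (polyfunD _ _ _ (Hf i) IH) => d _; rewrite big_cons.
Qed.

Lemma polyfunM m n f g : polyfun m f -> polyfun n g -> polyfun (m + n) (fun d => f d * g d).
Proof.
move=> [q sq qE] [r sr rE]; exists (q * r) => [|d dS]; last by rewrite hornerM qE ?rE.
rewrite (leq_trans (size_polyMleq _ _)) //; lia.
Qed.

Lemma polyfun_ffact t : polyfun t (fun d => (d ^_ t)%:R).
Proof.
elim: t => [|t IH]; first exact: polyfun_const.
have lin : polyfun 1 (fun d => d%:R - t%:R).
  exists ('X - t%:R%:P) => [|d _]; first by rewrite size_XsubC.
  by rewrite hornerXsubC.
rewrite -addn1; apply: eq_polyfun (polyfunM _ _ _ _ IH lin) => d _.
(* Truncated and true subtraction differ for [d < t], but there [d ^_ t] is 0. *)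
rewrite addn1 ffactnSr natrM; have [dt|td] := ltnP d t.
  by rewrite ffact_small // !mul0r.
by rewrite natrB.
Qed.

Lemma polyfun_ffactB t : polyfun t (fun d => ((S - d) ^_ t)%:R).
Proof.
have [q sq qE] := polyfun_ffact t.
exists (q \Po (S%:R%:P - 'X)) => [|d dS].
  apply: leq_trans (size_comp_poly_leq _ _) _.
  by rewrite -opprB size_polyN size_XsubC muln1; case: (size q) sq.
by rewrite horner_comp hornerD hornerC hornerN hornerX -natrB // -qE // leq_subr.
Qed.

End PolyFun.

(** * Means over the uniform designs *)

Section Mean.
Variables (R : rcfType) (K v S : nat).
Hypothesis v2 : (2 <= v)%N.
Hypothesis SK : (S <= K)%N.

Lemma sum_neq0_1 : \sum_(a : level v | a != ord0) 1 = v%:R :> R.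
Proof.
by rewrite sumr_const (eq_card (B := predC1 ord0)) // cardC1 card_ord.
Qed.

Lemma sum_neq0_neq_1 (a : level v) : a != ord0 ->
  \sum_(b | (b != ord0) && (b != a)) 1 = v%:R - 1 :> R.
Proof. by move=> a0; rewrite -sum_neq0_1 [X in X - 1](bigD1 a) //= addrAC subrr add0r. Qed.

Lemma sum_marker_1 :
  \sum_ab @marker R v ab * 1%:P%:P = 1 + 'X * (v%:R *: (1 + (v%:R - 1) *: 'X))%:P.
Proof.
rewrite (sum_marker _ _ (fun=> 1)) /=; congr (_ + 'X * _%:P).
have -> : \sum_(a : level v | a != ord0) \sum_(b | (b != ord0) && (b != a)) 1 =
    (v%:R - 1) * v%:R :> R.
  rewrite -sum_neq0_1 mulr_sumr; apply: eq_bigr => a a0.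
  by rewrite sum_neq0_neq_1 // sum_neq0_1 mulr1.
by rewrite sum_neq0_1 scalerDr scalerA alg_polyC mul_polyC [_ * v%:R]mulrC.
Qed.

(** With b = #|J|, the factors in [J] contribute Y^b G(X), where G is the product of the e_k + s_k X
    and [g] lists its coefficients. The other K-b factors coincide, and the binomial theorem
    extracts Y^(S-b) and then X^(d-t). *)
Lemma coef_sum_prod (u : 'I_K -> level v * level v -> R) (J : {set 'I_K}) :
    (#|J| <= S)%N ->
    (forall k, k \in J -> u k (ord0, ord0) = 0) ->
    (forall k ab, k \notin J -> u k ab = 1) ->
  exists2 g : nat -> R, g 0%N = \prod_(k in J) \sum_(a | a != ord0) u k (a, a) & forall d,
    \sum_(x | inXd S d x) \prod_k u k (x.1 k, x.2 k) =
    'C(K - #|J|, S - #|J|)%:R * v%:R ^+ (S - #|J|) *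
    \sum_(t < #|J|.+1) g t *
      (if (d < t)%N then 0 else (v%:R - 1) ^+ (d - t) * 'C(S - #|J|, d - t)%:R).
Proof.
move=> JS u0 u1; set b := #|J|.
pose gk k : {poly R} := (\sum_(a | a != ord0) u k (a, a))%:P +
  (\sum_(a | a != ord0) \sum_(c | (c != ord0) && (c != a)) u k (a, c))%:P * 'X.
pose G := \prod_(k in J) gk k.
have szG : (size G <= b.+1)%N.
  apply: leq_trans (size_prod_leq _ _) _.
  have sz2 : (\sum_(k in J) size (gk k) <= \sum_(k in J) 2)%N.
    apply: leq_sum => k _; rewrite /gk addrC size_MXaddC.
    case: ifP => // _; rewrite ltnS; exact: size_polyC_leq1.
  move: sz2; rewrite sum_nat_const -/b; lia.
exists (fun t => G`_t) => [|d].
  rewrite -horner_coef0 horner_prod; apply: eq_bigr => k _.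
  by rewrite !hornerE ?mulr0 ?addr0.
rewrite sum_prod_inXd (bigID (mem J)) /=.
rewrite (eq_bigr (fun k => 'X * (gk k)%:P)); last first.
  by move=> k kJ; rewrite sum_marker u0 // add0r.
rewrite [X in _ * X](eq_bigr
    (fun=> 1 + 'X * (v%:R *: (1 + (v%:R - 1) *: 'X))%:P)); last first.
  move=> k kJ; rewrite -sum_marker_1; apply: eq_bigr => ab _.
  by rewrite u1.
rewrite big_split /= !prodr_const -rmorph_prod /= -/G -/b.
have -> : #|[pred k | k \notin J]| = (K - b)%N.
  by rewrite -[K in RHS]card_ord -(cardC (mem J)) -/b addKn; apply: eq_card.
rewrite -mulrA coefXnM ltnNge JS /= coefCM.
set h := (X in X%:P).
have -> : ((1 + 'X * h%:P) ^+ (K - b))`_(S - b) = h ^+ (S - b) *+ 'C(K - b, S - b).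
  rewrite exprDn coef_sum (bigD1 (inord (S - b))) //= inordK; last by lia.
  rewrite big1 ?addr0; last first.
    move=> i; rewrite -val_eqE /= inordK; last by lia.
    move=> ib; rewrite expr1n mul1r exprMn -rmorphXn /= coefMn coefMC coefXn.
    by rewrite eq_sym (negPf ib) mul0r mul0rn.
  by rewrite expr1n mul1r exprMn -rmorphXn /= coefMn coefMC coefXn eqxx mul1r.
rewrite /h exprZn -scaler_nat scalerA -scalerAr coefZ; congr (_ * _).
have {1}-> : G = \sum_(t < b.+1) G`_t *: 'X^t.
  rewrite -poly_def; apply/polyP => i; rewrite coef_poly ltnS.
  by case: leqP => // bi; rewrite nth_default // (leq_trans szG).
rewrite mulr_suml coef_sum; apply: eq_bigr => t _.
rewrite -scalerAl coefZ coefXnM; case: ifP => // _; congr (_ * _).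
set m := (d - t)%N; set n := (S - b)%N.
(* For m > n the expansion has no term of degree m, and the binomial coefficient is 0 as well. *)
rewrite exprDn coef_sum; have [mn|nm] := leqP m n.
  rewrite (bigD1 (inord m)) //= inordK ?ltnS // big1 ?addr0.
    by rewrite expr1n mul1r exprZn coefMn coefZ coefXn eqxx mulr1 mulr_natr.
  move=> i; rewrite -val_eqE /= inordK ?ltnS // => im.
  by rewrite expr1n mul1r exprZn coefMn coefZ coefXn eq_sym (negPf im) mulr0 mul0rn.
rewrite bin_small // mulr0 big1 // => i _.
rewrite expr1n mul1r exprZn coefMn coefZ coefXn gtn_eqF ?mulr0 ?mul0rn //.
by apply: leq_ltn_trans nm; rewrite -ltnS.
Qed.

(** Weights 1 and empty [J], for which [g 0] is an empty product. *)
Lemma card_inXd d :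
  #|[pred x : pairT K v | inXd S d x]|%:R =
  'C(K, S)%:R * v%:R ^+ S * ((v%:R - 1) ^+ d * 'C(S, d)%:R) :> R.
Proof.
have [|k||g g0 /(_ d)] := @coef_sum_prod (fun _ _ => 1) set0; rewrite ?cards0 ?inE //.
rewrite big_ord1 /= g0 big_set0 mul1r !subn0 => <-.
by rewrite -sumr_const; apply: eq_bigr => x _; rewrite big1.
Qed.

Lemma v1_gt0 : 0 < v%:R - 1 :> R.
Proof. by rewrite subr_gt0 ltr1n. Qed.

Lemma card_inXd_neq0 d : (d <= S)%N ->
  #|[pred x : pairT K v | inXd S d x]|%:R != 0 :> R.
Proof.
move=> dS; rewrite card_inXd !mulf_neq0 ?expf_neq0 ?(gt_eqF v1_gt0) //.
- by rewrite pnatr_eq0 -lt0n bin_gt0.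
- by rewrite pnatr_eq0 -lt0n; lia.
- by rewrite pnatr_eq0 -lt0n bin_gt0.
Qed.

Lemma sum_unif (w : pairT K v -> R) d :
  \sum_x @unif R K v S d x * w x =
  (\sum_(x | inXd S d x) w x) / #|[pred x : pairT K v | inXd S d x]|%:R.
Proof.
rewrite mulr_suml [RHS]big_mkcond; apply: eq_bigr => x _; rewrite ffunE.
by case: ifP => _; rewrite ?mul0r // mulrC.
Qed.

(** Division by the number of pairs cancels (v-1)^d and leaves, for each t, a multiple of a product
    of falling factorials of degrees t and b-t in d. *)
Lemma polyfun_mean (u : 'I_K -> level v * level v -> R) (J : {set 'I_K}) :
    (#|J| <= S)%N ->
    (forall k, k \in J -> u k (ord0, ord0) = 0) ->
    (forall k ab, k \notin J -> u k ab = 1) ->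
  polyfun R S #|J| (fun d => \sum_x unif R K v S d x * \prod_k u k (x.1 k, x.2 k)).
Proof.
move=> JS u0 u1; have [g _ gE] := coef_sum_prod u J JS u0 u1; set b := #|J| in JS gE *.
(* [c] collects what depends on neither d nor t, including the constant from [bin_ffact_ratio]. *)
pose c : R := 'C(K - b, S - b)%:R * v%:R ^+ (S - b) / ('C(K, S)%:R * v%:R ^+ S) /
  (S ^_ b)%:R.
apply: (@eq_polyfun _ _ _ (fun d => \sum_(t < b.+1)
    c * g t / (v%:R - 1) ^+ t * ((d ^_ t)%:R * ((S - d) ^_ (b - t))%:R))).
  move=> d dS; rewrite sum_unif gE card_inXd mulr_sumr mulr_suml.
  apply: eq_bigr => t _; case: ltnP => [dt|td].
    by rewrite ffact_small // !(mul0r, mulr0).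
  have tb : (t <= b)%N by rewrite -ltnS.
  have /(congr1 (fun n => n%:R : R)) := bin_ffact_ratio S b d t tb JS td dS.
  rewrite !natrM => e.
  have w0 := gt_eqF v1_gt0.
  have b0 : (S ^_ b)%:R != 0 :> R by rewrite pnatr_eq0 -lt0n ffact_gt0.
  have K0 : 'C(K, S)%:R != 0 :> R by rewrite pnatr_eq0 -lt0n bin_gt0.
  have d0 : 'C(S, d)%:R != 0 :> R by rewrite pnatr_eq0 -lt0n bin_gt0.
  have vS : v%:R ^+ S != 0 :> R by rewrite expf_neq0 // pnatr_eq0 -lt0n; lia.
  have wt : (v%:R - 1) ^+ t != 0 :> R by rewrite expf_neq0 // w0.
  have wd : (v%:R - 1) ^+ (d - t) != 0 :> R by rewrite expf_neq0 // w0.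
  have -> : (v%:R - 1) ^+ d = (v%:R - 1) ^+ (d - t) * (v%:R - 1) ^+ t :> R.
    by rewrite -exprD subnK.
  have -> : 'C(S - b, d - t)%:R = 'C(S, d)%:R * ((d ^_ t)%:R * ((S - d) ^_ (b - t))%:R)
      / (S ^_ b)%:R :> R by rewrite -e mulfK.
  rewrite /c; move: ((v%:R - 1) ^+ t) wt => x x0.
  move: ((v%:R - 1) ^+ (d - t)) wd => y y0.
  move: (v%:R ^+ S) vS => z z0.
  by field; rewrite x0 y0 z0 b0 K0 d0.
apply: polyfun_sum => t; apply: polyfunZ.
apply: (@polyfunW _ _ (t + (b - t))); first by rewrite subnKC // -ltnS.
apply: polyfunM; [exact: polyfun_ffact | exact: polyfun_ffactB].
Qed.

(** The factor of attribute [k] is the zero polynomial, which kills the whole product. *)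
Lemma mean_eq0 (u : 'I_K -> level v * level v -> R) k d :
    u k (ord0, ord0) = 0 -> \sum_(a | a != ord0) u k (a, a) = 0 ->
    \sum_(a | a != ord0) \sum_(b | (b != ord0) && (b != a)) u k (a, b) = 0 ->
  \sum_x unif R K v S d x * \prod_k u k (x.1 k, x.2 k) = 0.
Proof.
move=> u0 e0 s0; rewrite sum_unif sum_prod_inXd (bigD1 k) //= sum_marker u0 e0 s0.
by rewrite mul0r addr0 mulr0 add0r mul0r !coef0 mul0r.
Qed.

End Mean.

(** * Information matrices and the equivalence theorem *)

Section Information.
Variables (R : rcfType) (K v : nat).
Hypothesis v2 : (2 <= v)%N.

(** Only two levels contribute: i+1 gives 1, as coordinates count from 0, and v gives -1. *)
Lemma sum_f1 (i : 'I_v.-1) : \sum_(a : level v | a != ord0) f1 R a i = 0.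
Proof.
have f10 : f1 R ord0 i = 0 by rewrite /f1 eqxx.
have -> : \sum_(a : level v | a != ord0) f1 R a i = \sum_(a : level v) f1 R a i.
  by rewrite [RHS](bigD1 ord0) //= f10 add0r.
case: v v2 i f10 => // n _ i f10; rewrite big_ord_recl big_ord_recr f10 add0r /=.
rewrite (bigD1 i) //= big1 ?addr0; last first.
  move=> j ji; rewrite /f1 /= /bump /= add1n eqSS ltn_eqF ?ltn_ord //=.
  by rewrite (inj_eq val_inj) (negPf ji).
by rewrite /f1 /= /bump /= !add1n eqSS ltn_eqF ?ltn_ord //= !eqxx subrr.
Qed.

Lemma sum_f1_neq (a : level v) (i : 'I_v.-1) : a != ord0 ->
  \sum_(b | (b != ord0) && (b != a)) f1 R b i = - f1 R a i.
Proof.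
move=> a0; apply/eqP; rewrite -addr_eq0 addrC; apply/eqP.
by rewrite -[RHS](sum_f1 i) [RHS](bigD1 a).
Qed.

Definition f1opt (o : option 'I_v.-1) (a : level v) : R :=
  if o is Some i then f1 R a i else 1.

(** The boolean selects a profile, so that the four products in the expansion of (f(i)-f(j))_r
    (f(i)-f(j))_c are treated uniformly. *)
Definition side (s : bool) (ab : level v * level v) := if s then ab.1 else ab.2.

(** The inner sum multiplies f_1(a) by v-1 or by -1, according to the side; [sum_f1] then
    applies. *)
Lemma sum_pair_f1 s (i : 'I_v.-1) :
  \sum_(a : level v | a != ord0) \sum_(b | (b != ord0) && (b != a))
     f1 R (side s (a, b)) i = 0.
Proof.
case: s => /=.
  under eq_bigr => a a0 do rewrite sumr_const.
  rewrite (eq_bigr (fun a => f1 R a i * (v%:R - 1))).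
    by rewrite -mulr_suml sum_f1 mul0r.
  move=> a a0; rewrite -sumr_const -(sum_neq0_neq_1 R v a) // mulr_sumr.
  by apply: eq_bigr => b _; rewrite mulr1.
under eq_bigr => a a0 do rewrite (sum_f1_neq a i a0).
by rewrite sumrN sum_f1 oppr0.
Qed.

Variable S : nat.
Hypothesis S3 : (3 <= S)%N.
Hypothesis SK : (S <= K)%N.

(** For equal sets of chosen attributes this is [polyfun_mean] with #|J| <= 3; otherwise the mean is
    identically 0. *)
Lemma polyfun_mean_fval (s t : bool) (r c : fidx K v) :
  polyfun R S 3 (fun d => \sum_x unif R K v S d x *
    (fval R (if s then x.1 else x.2) r * fval R (if t then x.1 else x.2) c)).
Proof.
pose u k ab : R := f1opt (val r k) (side s ab) * f1opt (val c k) (side t ab).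
apply: (@eq_polyfun _ _ _ (fun d => \sum_x unif R K v S d x *
    \prod_k u k (x.1 k, x.2 k))).
  move=> d _; apply: eq_bigr => x _; rewrite /fval -big_split /=; congr (_ * _).
  by apply: eq_bigr => k _; rewrite /u; case: (s); case: (t).
have f10 o s' : o != None -> f1opt o (side s' (ord0, ord0)) = 0.
  by case: o s' => // i []; rewrite /side /= /f1 eqxx.
have [/forallP e|] := boolP [forall k, (val r k == None) == (val c k == None)].
  pose J := [set k | val r k != None].
  have J3 : (#|J| <= 3)%N by rewrite cardsE; case/andP: (valP r).
  apply: (polyfunW _ _ _ _ _ J3); apply: polyfun_mean => //.
  - exact: leq_trans J3 S3.
  - by move=> k; rewrite inE /u => kJ; rewrite f10 // mul0r.
  - move=> k ab; rewrite inE negbK /u => kJ.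
    by have := e k; rewrite (eqP kJ) eqxx eq_sym eqb_id => /eqP ->; rewrite mulr1.
rewrite negb_forall => /existsP[k].
(* Only one of the two factors is an f_1: it vanishes at level 0 and sums to zero over equal and
   over distinct nonzero levels. *)
have H : forall o o' s' t', (o == None) != (o' == None) ->
  let w ab := f1opt o (side s' ab) * f1opt o' (side t' ab) in
  [/\ w (ord0, ord0) = 0, \sum_(a | a != ord0) w (a, a) = 0 &
    \sum_(a | a != ord0) \sum_(b | (b != ord0) && (b != a)) w (a, b) = 0].
  move=> [i|] [j|] // s' t' _ w; rewrite /w; split.
  - by rewrite f10 // mul0r.
  - by rewrite -[RHS](sum_f1 i); apply: eq_bigr => a _; rewrite /= mulr1; case: (s').
  - rewrite -[RHS](sum_pair_f1 s' i); apply: eq_bigr => a _; apply: eq_bigr => b _.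
    by rewrite /= mulr1.
  - by rewrite [X in _ * X]f10 // mulr0.
  - by rewrite -[RHS](sum_f1 j); apply: eq_bigr => a _; rewrite /= mul1r; case: (t').
  - rewrite -[RHS](sum_pair_f1 t' j); apply: eq_bigr => a _; apply: eq_bigr => b _.
    by rewrite /= mul1r.
move=> /(H _ _ s t)[w0 w1 w2].
apply: (@eq_polyfun _ _ _ (fun=> 0)); last exact: polyfun_const.
by move=> d _; rewrite (@mean_eq0 _ _ _ _ u k).
Qed.

Lemma polyfun_infoM r c : polyfun R S 3 (fun d => infoM (unif R K v S d) r c).
Proof.
have H s t := polyfun_mean_fval s t (enum_val r) (enum_val c).
have same := polyfunD _ _ _ _ _ (H true true) (H false false).
have cross := polyfunD _ _ _ _ _ (H true false) (H false true).
apply: eq_polyfun (polyfunD _ _ _ _ _ same (polyfunZ _ _ _ (-1) _ cross)).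
move=> d _; rewrite mxE -!big_split mulr_sumr -big_split /=.
apply: eq_bigr => x _; rewrite /fdiff; ring.
Qed.

(** Provides V(0) = 0: at depth 0 the two profiles coincide. *)
Lemma infoM_depth0 : infoM (unif R K v S 0) = 0.
Proof.
apply/matrixP => r c; rewrite !mxE big1 // => x _; rewrite ffunE.
rewrite /inXd; case: ifP => [/andP[_ /eqP d0]|_]; last by rewrite !mul0r.
suff e : x.1 = x.2 by rewrite /fdiff e !subrr mulr0.
apply/ffunP => k; apply/eqP; apply: contraT => ne.
by have := card0_eq d0 k; rewrite inE ne.
Qed.

Lemma is_design_unif d : (d <= S)%N -> is_design S (unif R K v S d).
Proof.
move=> dS; split; [|split] => [x||x].
- by rewrite ffunE; case: ifP => // _; rewrite invr_ge0 ler0n.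
- transitivity (\sum_x unif R K v S d x * 1); first by apply: eq_bigr => x; rewrite mulr1.
  by rewrite sum_unif sumr_const divff // card_inXd_neq0.
- by rewrite ffunE /inXd; case: ifP => [/andP[]|]; rewrite ?eqxx.
Qed.

Lemma infoM_psd (xi : {ffun pairT K v -> R}) (x : 'rV_(p K v)) :
  (forall y, 0 <= xi y) -> 0 <= (x *m infoM xi *m x^T) 0 0.
Proof.
move=> xi0.
have -> : (x *m infoM xi *m x^T) 0 0 = \sum_y xi y * (\sum_r x 0 r * fdiff R y r) ^+ 2.
  rewrite mxE; under eq_bigr => c _ do rewrite !mxE mulr_suml.
  rewrite exchange_big /=.
  under eq_bigr => r _.
    under eq_bigr => c _ do rewrite mxE mulr_sumr mulr_suml.
    rewrite exchange_big /=; over.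
  rewrite exchange_big /=; apply: eq_bigr => y _.
  rewrite expr2 mulr_suml mulr_sumr; apply: eq_bigr => r _.
  rewrite !mulr_sumr; apply: eq_bigr => c _; ring.
by apply: sumr_ge0 => y _; rewrite mulr_ge0 // sqr_ge0.
Qed.

Definition mix (t : R) (xi eta : {ffun pairT K v -> R}) : {ffun pairT K v -> R} :=
  [ffun x => (1 - t) * xi x + t * eta x].

Lemma is_design_mix t xi eta : 0 <= t <= 1 ->
  is_design S xi -> is_design S eta -> is_design S (mix t xi eta).
Proof.
move=> /andP[t0 t1] [xi0 [xi1 xiX]] [eta0 [eta1 etaX]]; split; [|split] => [x||x].
- by rewrite ffunE addr_ge0 ?mulr_ge0 ?subr_ge0.
- under eq_bigr => x _ do rewrite ffunE.
  by rewrite big_split /= -!mulr_sumr xi1 eta1 !mulr1 subrK.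
- rewrite ffunE; have [->|/xiX //] := eqVneq (xi x) 0.
  have [->|/etaX //] := eqVneq (eta x) 0.
  by rewrite !mulr0 addr0 eqxx.
Qed.

Lemma infoM_mix t xi eta : infoM (mix t xi eta) = (1 - t) *: infoM xi + t *: infoM eta.
Proof.
apply/matrixP => r c; rewrite !mxE !mulr_sumr -big_split /=.
by apply: eq_bigr => x _; rewrite ffunE; ring.
Qed.

Lemma infoM_invdesign (w : nat -> R) :
  infoM (invdesign K v S w) = \sum_(1 <= d < S.+1) w d *: infoM (unif R K v S d).
Proof.
apply/matrixP => r c; rewrite summxE mxE.
under [RHS]eq_bigr => d _ do rewrite !mxE mulr_sumr.
rewrite exchange_big /=; apply: eq_bigr => x _.
by rewrite ffunE -mulrA mulr_suml; apply: eq_bigr => d _; rewrite !mulrA.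
Qed.

(* Kiefer-Wolfowitz equivalence theorem, necessity *)
Lemma D_optimal_trace_le (xi eta : {ffun pairT K v -> R}) :
  D_optimal S xi -> is_design S eta ->
  \tr (invmx (infoM xi) *m infoM eta) <= (p K v)%:R.
Proof.
move=> [xid [detM opt]] etad; set M := infoM xi; set N := infoM eta.
have Mu : M \in unitmx by rewrite unitmxE unitfE.
have M0 : 0 < \det M.
  by apply: det_gt0_posdef => // x; apply: infoM_psd; case: xid.
(* For B = M^-1 N - 1, the matrix M (1 + t B) is the information matrix of the mixture (1-t) xi + t
   eta, so optimality and det M > 0 give det (1 + t B) <= 1. *)
rewrite -subr_le0 -[X in _ - X](mxtrace1 R) -raddfB /=; apply: trace_le0_det => t t01.
rewrite -(ler_pM2l M0) mulr1 -det_mulmx.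
have -> : M *m (1%:M + t *: (invmx M *m N - 1%:M)) = infoM (mix t xi eta).
  rewrite infoM_mix -/M -/N mulmxDr mulmx1 -scalemxAr mulmxBr mulmx1 mulKVmx //.
  by rewrite scalerBr scalerBl scale1r addrA addrAC.
exact/opt/is_design_mix.
Qed.

End Information.

(** * Depths used by an optimal invariant design *)

Theorem theorem3 (R : rcfType) (v K S : nat)
  (hv : (2 <= v)%N) (hK : (3 <= K)%N) (hS3 : (3 <= S)%N) (hSK : (S <= K)%N)
  (w : nat -> R)
  (hw0 : forall d, (1 <= d <= S)%N -> 0 <= w d)
  (hw1 : \sum_(1 <= d < S.+1) w d = 1)
  (hopt : D_optimal S (@invdesign R K v S w)) :
  (#|[set d : 'I_S.+1 | (0 < d)%N && (0 < w d)%R]| <= 3)%N /\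
  exists2 ds : nat, (1 <= ds <= S)%N &
    forall d : nat, (1 <= d <= S)%N -> 0 < w d ->
      d = ds \/ d = ds.+1 \/ d = S.
Proof.
set M := infoM (invdesign K v S w).
pose V d := \tr (invmx M *m infoM (unif R K v S d)).
have Mu : M \in unitmx by rewrite unitmxE unitfE; case: hopt => _ [].
have Vle d : (d <= S)%N -> V d <= (p K v)%:R.
  by move=> dS; apply: D_optimal_trace_le hopt _; apply: is_design_unif.
(* The w-average of the M(xi_d) is M, so that of V is tr(M^-1 M) = p. *)
have sumV : \sum_(1 <= d < S.+1) w d * ((p K v)%:R - V d) = 0.
  under eq_bigr => d _ do rewrite mulrBr.
  rewrite sumrB -mulr_suml hw1 mul1r; apply/eqP; rewrite subr_eq0; apply/eqP.
  rewrite -[LHS](mxtrace1 R) -(mulVmx Mu) {2}/M infoM_invdesign mulmx_sumr raddf_sum /=.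
  by apply: eq_bigr => d _; rewrite -scalemxAr mxtraceZ.
(* All terms of the vanishing sum [sumV] are nonnegative, hence zero. *)
have Veq d : (1 <= d <= S)%N -> 0 < w d -> V d = (p K v)%:R.
  move=> dS wd; move: sumV; rewrite big_nat => /eqP.
  rewrite psumr_eq0 => [/allP/(_ d)|e eS]; last first.
    by rewrite mulr_ge0 ?hw0 ?subr_ge0 ?Vle //; case/andP: eS.
  rewrite mem_index_iota !ltnS dS => /(_ isT) /=.
  by rewrite mulf_eq0 gt_eqF //= subr_eq0 => /eqP ->.
have [q sq qE] : polyfun R S 3 V.
  apply: (@eq_polyfun _ _ _ (fun d => \sum_i \sum_j
      invmx M i j * infoM (unif R K v S d) j i)).
    by move=> d _; apply: eq_bigr => i _; rewrite !mxE.
  apply: polyfun_sum => i; apply: polyfun_sum => j; apply: polyfunZ.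
  exact: polyfun_infoM.
(* This makes the cubic V - p strictly negative at 0. The witness is a main-effect coordinate, with
   a single chosen attribute. *)
have p0 : (0 < p K v)%N.
  have k0 : 'I_K by exists 0%N; lia.
  have a0 : 'I_v.-1 by exists 0%N; lia.
  pose j : {ffun 'I_K -> option 'I_v.-1} := [ffun k => if k == k0 then Some a0 else None].
  have j1 : #|[pred k | j k != None]| = 1%N.
    by apply: (eq_card1 (x := k0)) => k; rewrite unfold_in /= ffunE inE; case: (k == k0).
  have jP : fidx_pred j by rewrite /fidx_pred j1.
  by apply/card_gt0P; exists (exist _ j jP).
pose Q := q - (p K v)%:R%:P.
have QE d : (d <= S)%N -> Q.[d%:R] = V d - (p K v)%:R.
  by move=> dS; rewrite !hornerE qE.
have [ds dsS dsP] : exists2 ds : nat, (1 <= ds <= S)%N &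
    forall d, (1 <= d <= S)%N && (0 < w d) -> d = ds \/ d = ds.+1 \/ d = S.
  apply: (support_shape (fun d => (1 <= d <= S)%N && (0 < w d))).
  - by apply: leq_trans hS3.
  - by move=> d /andP[].
  move=> a b /andP[aS wa] /andP[bS wb] ab.
  have rQ d : (1 <= d <= S)%N -> 0 < w d -> root Q d%:R.
    by move=> dS wd; rewrite rootE QE ?Veq ?subrr //; case/andP: dS.
  case/andP: (aS) => a1 _; case/andP: (bS) => _ bS'.
  apply: (root_gap_le1 _ Q) => //; [| | |exact: rQ|exact: rQ].
  - rewrite (leq_trans (size_polyD _ _)) // geq_max sq size_polyN.
    exact: leq_trans (size_polyC_leq1 _) _.
  - rewrite (QE 0%N) // /V infoM_depth0 mulmx0 mxtrace0 sub0r oppr_lt0.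
    by rewrite ltr0n.
  - by move=> d /andP[_ dS]; rewrite QE // subr_le0 Vle.
split; last by exists ds => // d dS wd; apply: dsP; rewrite dS.
(* If [ds = S], then [inord ds.+1] is a default element; it can only enlarge the covering set, which
   still has at most three elements. *)
apply: leq_trans (_ : #|[set inord ds; inord ds.+1; inord S : 'I_S.+1]| <= 3)%N.
  apply/subset_leq_card/subsetP => d; rewrite !inE => /andP[d0 wd].
  have dS : (d <= S)%N by rewrite -ltnS.
  have dP : (1 <= d <= S)%N && (0 < w d) by rewrite d0 dS.
  have dE n : d = n :> nat -> d == inord n by move=> <-; rewrite inord_val.
  by case: (dsP d dP) => [|[]] /dE ->; rewrite ?orbT.
by rewrite -setUA cardsU1 cards2; do 2!case: (_ \notin _) || case: (_ != _).
Qed.
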